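(* In the regime $\lambda_u/\lambda_2\to0$ (in which $p_{{\rm a},2}\to0$), the optimal caching probability, i.e. the maximizer of the limiting successful offloading probability $$\sum_{f=1}^{N_f}\frac{p_f\,q_{f,2}}{\mathcal C_{1,\gamma_0}+q_{f,2}}$$ over all $\mathbf q_2=(q_{1,2},\dots,q_{N_f,2})$ with $\sum_{f=1}^{N_f}q_{f,2}\le N_c$ and $0\le q_{f,2}\le1$ for $f=1,\dots,N_f$, is $$q_{f,2}^*=\left[\sqrt{\frac{\mathcal C_{1,\gamma_0}}{\nu}}\,\sqrt{p_f}-\mathcal C_{1,\gamma_0}\right]_0^1,\qquad f=1,\dots,N_f,$$ where $\nu>0$ is chosen so that $\sum_{f=1}^{N_f}q_{f,2}^*=N_c$.
   Context: $[x]_0^1=\max\{\min\{x,1\},0\}$. Parameters: $\lambda_1,\lambda_2,\lambda_u,P_1,P_2,B_1,B_2,\gamma_0>0$, $\alpha>2$, integer $M_1\ge1$, $M_2=1$; $\lambda_{12}=\lambda_1/\lambda_2$, $P_{12}=P_1/P_2$, $B_{12}=B_1/B_2$, $M_{12}=M_1/M_2$. $N_f$ is the number of files, $N_c$ is the cache capacity of each helper, a positive integer with $N_c\le N_f$, and $p_f=f^{-\delta}/\sum_{n=1}^{N_f}n^{-\delta}$ with $\delta>0$. ${}_2F_1$ is the Gauss hypergeometric function (analytically continued to the negative real axis), $\Gamma$ the Gamma function, and $$\mathcal C_{1,\gamma_0}=\lambda_{12}(P_{12}B_{12})^{2/\alpha}\,{}_2F_1\Big[-\tfrac2\alpha,M_1;1-\tfrac2\alpha;-\tfrac{\gamma_0}{M_{12}B_{12}}\Big],\quad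 \mathcal C_{2,\gamma_0}=\frac{\Gamma(1-\frac2\alpha)\Gamma(M_2+\frac2\alpha)}{\Gamma(M_2)}\gamma_0^{2/\alpha},$$ $$\mathcal C_{3,\gamma_0}={}_2F_1\Big[-\tfrac2\alpha,M_2;1-\tfrac2\alpha;-\gamma_0\Big]-\mathcal C_{2,\gamma_0}-1.$$ For a caching probability vector $\mathbf q_2\in[0,1]^{N_f}$ the successful offloading probability is $$P_{\rm off}(\mathbf q_2)=\sum_{f=1}^{N_f}\frac{p_fq_{f,2}}{\mathcal C_{1,\gamma_0}+\mathcal C_{2,\gamma_0}p_{{\rm a},2}+\mathcal C_{3,\gamma_0}p_{{\rm a},2}q_{f,2}+q_{f,2}},$$ $$p_{{\rm a},2}=1-\bigg(1+\frac{\lambda_u}{3.5\lambda_2}\sum_{f=1}^{N_f}\frac{p_fq_{f,2}}{\lambda_{12}(P_{12}B_{12})^{2/\alpha}+q_{f,2}}\bigg)^{-3.5}.$$ ''The regime $\lambda_u/\lambda_2\to0$'' means that $\lambda_u/\lambda_2\to0$ with all other parameters (including $\lambda_{12}$) fixed, and the limiting successful offloading probability is the corresponding pointwise limit of $P_{\rm off}$. *)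

(* Defs.v *)
From Stdlib Require Import Reals Factorial ClassicalEpsilon Lra.
From Coquelicot Require Import Coquelicot.
Open Scope R_scope.

(** Rising factorial [a (a+1) ... (a+n-1)]. *)
Fixpoint pochhammer (a : R) (n : nat) : R :=
  match n with
  | O => 1
  | S m => pochhammer a m * (a + INR m)
  end.

Definition hyp2F1_coeff (a b c : R) (n : nat) : R :=
  pochhammer a n * pochhammer b n / (pochhammer c n * INR (fact n)).

Definition analytic_at (F : R -> R) (x0 : R) : Prop :=
  exists u : nat -> R, locally x0 (fun x => is_pseries u (x - x0) (F x)).

(** [F] continues Gauss's series real-analytically from [(-1,1)] to
    [(-oo,1)].  By the identity theorem there is at most one such function on
    [(-oo,1)]; one exists whenever [c] is not a nonpositive integer. *)
Definition continues_hyp2F1 (a b c : R) (F : R -> R) : Prop :=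
  (forall x, Rabs x < 1 -> is_pseries (hyp2F1_coeff a b c) x (F x)) /\
  (forall x, x < 1 -> analytic_at F x).

(** Meaningful for [x < 1] and [c] not a nonpositive integer. *)
Definition hyp2F1 (a b c : R) : R -> R :=
  epsilon (inhabits (fun _ : R => 0)) (continues_hyp2F1 a b c).

(** Euler's integral; meaningful for [0 < x]. *)
Definition Gamma (x : R) : R :=
  RInt_gen (fun t => Rpower t (x - 1) * exp (- t))
    (at_right 0) (Rbar_locally p_infty).

Record network : Type := Network {
  lam1 : R; lam2 : R; lamu : R;
  P1 : R; P2 : R;
  B1 : R; B2 : R;
  gamma0 : R;
  alpha : R;
  M1 : nat; M2 : nat;
  Nf : nat; (* number of files *)
  Nc : nat; (* cache capacity of a helper *)
  delta : R (* exponent of the file popularity *)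
}.

Definition admissible (s : network) : Prop :=
  (0 < lam1 s /\ 0 < lam2 s /\ 0 < lamu s) /\
  (0 < P1 s /\ 0 < P2 s) /\ (0 < B1 s /\ 0 < B2 s) /\
  0 < gamma0 s /\ 2 < alpha s /\
  (1 <= M1 s)%nat /\ M2 s = 1%nat /\
  (1 <= Nc s <= Nf s)%nat /\ 0 < delta s.

Definition lam12 (s : network) : R := lam1 s / lam2 s.
Definition P12 (s : network) : R := P1 s / P2 s.
Definition B12 (s : network) : R := B1 s / B2 s.
Definition M12 (s : network) : R := INR (M1 s) / INR (M2 s).

(** Vectors indexed by the files [1, ..., Nf] are functions on [nat], of which
    only the values at [1, ..., Nf] matter. *)
Definition is_file (s : network) (f : nat) : Prop := (1 <= f <= Nf s)%nat.

Definition sum_files (s : network) (x : nat -> R) : R := sum_n_m x 1 (Nf s).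

Definition popularity (s : network) (f : nat) : R :=
  Rpower (INR f) (- delta s) /
  sum_files s (fun n => Rpower (INR n) (- delta s)).

Definition C1 (s : network) : R :=
  lam12 s * Rpower (P12 s * B12 s) (2 / alpha s) *
  hyp2F1 (- (2 / alpha s)) (INR (M1 s)) (1 - 2 / alpha s)
    (- (gamma0 s / (M12 s * B12 s))).

Definition C2 (s : network) : R :=
  Gamma (1 - 2 / alpha s) * Gamma (INR (M2 s) + 2 / alpha s) /
  Gamma (INR (M2 s)) * Rpower (gamma0 s) (2 / alpha s).

Definition C3 (s : network) : R :=
  hyp2F1 (- (2 / alpha s)) (INR (M2 s)) (1 - 2 / alpha s) (- gamma0 s)
  - C2 s - 1.

Definition pa2 (s : network) (q : nat -> R) : R :=
  1 - Rpower
        (1 + lamu s / (3.5 * lam2 s) *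
             sum_files s (fun f => popularity s f * q f /
               (lam12 s * Rpower (P12 s * B12 s) (2 / alpha s) + q f)))
        (- 3.5).

Definition Poff (s : network) (q : nat -> R) : R :=
  sum_files s (fun f => popularity s f * q f /
    (C1 s + C2 s * pa2 s q + C3 s * pa2 s q * q f + q f)).

Definition Poff_lim (s : network) (q : nat -> R) : R :=
  sum_files s (fun f => popularity s f * q f / (C1 s + q f)).

Definition caching_vector (s : network) (q : nat -> R) : Prop :=
  forall f, is_file s f -> 0 <= q f <= 1.

Definition feasible (s : network) (q : nat -> R) : Prop :=
  caching_vector s q /\ sum_files s q <= INR (Nc s).

Definition unique_maximizer (s : network) (obj : (nat -> R) -> R)
    (q : nat -> R) : Prop :=
  feasible s q /\
  (forall q', feasible s q' -> obj q' <= obj q) /\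
  (forall q', feasible s q' -> obj q' = obj q ->
     forall f, is_file s f -> q' f = q f).

Definition clip01 (x : R) : R := Rmax (Rmin x 1) 0.

Definition qstar (s : network) (nu : R) (f : nat) : R :=
  clip01 (sqrt (C1 s / nu) * sqrt (popularity s f) - C1 s).

Definition with_densities (s : network) (l1 l2 lu : R) : network :=
  Network l1 l2 lu (P1 s) (P2 s) (B1 s) (B2 s) (gamma0 s) (alpha s)
    (M1 s) (M2 s) (Nf s) (Nc s) (delta s).

(** The densities may all vary, as long as [lam1 / lam2] keeps its value. *)
Definition low_user_density (s : network) : (network -> Prop) -> Prop :=
  fun Q => exists eta : posreal, forall l1 l2 lu : R,
    0 < l1 -> 0 < l2 -> 0 < lu ->
    l1 / l2 = lam12 s -> lu / l2 < eta ->
    Q (with_densities s l1 l2 lu).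

Lemma low_user_density_proper (s : network) :
  0 < lam12 s -> ProperFilter (low_user_density s).
Proof.
intros H; split; [| split].
- intros Q [eta HQ]; exists (with_densities s (lam12 s) 1 (eta / 2)).
  pose proof (cond_pos eta); apply HQ; lra.
- exists (mkposreal 1 Rlt_0_1); auto.
- intros Q Q' [e1 H1] [e2 H2].
  exists (mkposreal _ (Rmin_stable_in_posreal e1 e2)); simpl; intros.
  split; [apply H1 | apply H2]; auto;
    eapply Rlt_le_trans; eauto using Rmin_l, Rmin_r.
- intros Q Q' HQ [e He]; exists e; auto.
Qed.

(* Main.v *)
Require Import Defs.
From Stdlib Require Import Reals Factorial Lra Lia ClassicalEpsilon Classical.
From Coquelicot Require Import Coquelicot.
(* Again, because Stdlib also has a [C1]. *)
Import Defs.
Open Scope R_scope.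

(** [C1 > 0] because [2F1(-beta, M; 1-beta; x) >= 1] for [x <= 0] and
    [0 < beta < 1], which follows from Euler's integral; this integral also
    gives the analytic continuation of Gauss's series to [(-oo, 1)], and the
    identity theorem makes it the only one.  Given [C1 > 0], each
    [p q / (C1 + q) - nu q] is strictly concave in [q] and maximal on [0, 1]
    exactly at [qstar], so [nu] is a Lagrange multiplier for the cache
    constraint; [nu] exists by the intermediate value theorem applied to the
    total caching probability as a function of [sqrt (C1 / nu)]. *)

(** * Uniqueness of the analytic continuation *)

(** Otherwise a point [y] strictly between [Rabs x] and 1 would lie outside the disk of convergence,
    where the terms cannot tend to 0. The strict bound on the radius is what the Cauchy product in
    [geom_kernel_pseries] asks for. *)
Lemma CV_radius_unit_disk (a : nat -> R) (x : R) :
  (forall y, Rabs y < 1 -> ex_series (fun n => a n * y ^ n)) ->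
  Rabs x < 1 -> Rbar_lt (Rabs x) (CV_radius a).
Proof.
intros Ha Hx.
apply Rbar_not_le_lt; intros Hle.
pose proof (Rabs_pos x).
set (y := (Rabs x + 1) / 2).
assert (Hy : Rabs y = y) by (apply Rabs_pos_eq; unfold y; lra).
apply (CV_disk_outside a y).
- eapply Rbar_le_lt_trans; [exact Hle|].
  simpl; rewrite Hy; unfold y; lra.
- apply ex_series_lim_0, Ha; rewrite Hy; unfold y; lra.
Qed.

(** Convergence at [d / 2] makes the radius positive, so the sum is continuous at 0, where its value
    is [u 0]; but it vanishes at points arbitrarily close to 0. *)
Lemma pseries_zero_right_coeff0 (u : nat -> R) (d : R) :
  0 < d -> (forall h, 0 < h < d -> is_pseries u h 0) -> u 0%nat = 0.
Proof.
intros Hd Hu.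
assert (Hr : Rbar_lt (Rabs 0) (CV_radius u)).
{ rewrite Rabs_R0.
  apply Rbar_not_le_lt; intros Hle.
  apply (CV_disk_outside u (d / 2)).
  - eapply Rbar_le_lt_trans; [exact Hle|].
    simpl; rewrite Rabs_pos_eq; lra.
  - apply ex_series_lim_0; exists 0; apply is_pseries_R, Hu; lra. }
apply PSeries_continuity, continuity_pt_filterlim in Hr.
rewrite PSeries_0 in Hr.
destruct (Req_dec (u 0%nat) 0) as [E|E]; [exact E|exfalso].
apply Rabs_pos_lt in E.
destruct (proj1 (filterlim_locally _ _) Hr (mkposreal _ E)) as [e He].
pose proof (cond_pos e).
set (h := Rmin e d / 2).
assert (0 < h < d /\ h < e) as [Hh Hhe].
{ unfold h; pose proof (Rmin_l e d); pose proof (Rmin_r e d).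
  assert (0 < Rmin e d) by (apply Rmin_pos; lra). lra. }
assert (Hb : ball (u 0%nat) (Rabs (u 0%nat)) (PSeries u h)).
{ apply He. change (Rabs (h - 0) < e).
  rewrite Rminus_0_r, Rabs_pos_eq; lra. }
rewrite (is_pseries_unique _ _ _ (Hu h Hh)) in Hb.
change (Rabs (0 - u 0%nat) < Rabs (u 0%nat)) in Hb.
rewrite Rminus_0_l, Rabs_Ropp in Hb; lra.
Qed.

(** Once the constant coefficient is 0, dividing by [h] gives the shifted series, which again
    vanishes on the right of 0. *)
Lemma pseries_zero_right_coeff (u : nat -> R) (d : R) (n : nat) :
  0 < d -> (forall h, 0 < h < d -> is_pseries u h 0) -> u n = 0.
Proof.
intros Hd; revert u; induction n as [|n IH]; intros u Hu.
- exact (pseries_zero_right_coeff0 u d Hd Hu).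
- apply (IH (PS_decr_1 u)); intros h Hh.
  assert (Hyx : mult (/ h) h = one).
  { change (/ h * h = 1); field; lra. }
  pose proof (is_pseries_decr_1 u h (/ h) 0 Hyx (Hu h Hh)) as H.
  rewrite (pseries_zero_right_coeff0 u d Hd Hu) in H.
  replace 0 with (scal (/ h) (plus 0 (opp 0))); [exact H|].
  change (/ h * (0 + - 0) = 0); ring.
Qed.

(* The zero set of [D] to the left of 0 cannot stop at a point [x0]: the
   expansion of [D] at [x0] vanishes on the right of [x0], hence identically. *)
Lemma analytic_vanishing (D : R -> R) :
  (forall x, x < 1 -> analytic_at D x) ->
  (forall x, Rabs x < 1 -> D x = 0) ->
  forall x, x < 1 -> D x = 0.
Proof.
intros Han H0 x1 Hx1.
destruct (Rlt_dec (-1) x1) as [Hl|Hl].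
{ apply H0, Rabs_def1; lra. }
apply Rnot_lt_le in Hl.
destruct (Req_dec (D x1) 0) as [E|E]; [exact E|exfalso].
(* The supremum [r0] of [Z] marks where the vanishing would stop; [Z] is bounded by [- x1] since
   [D x1] is assumed nonzero. *)
set (Z := fun r => 0 <= r /\ forall z, - r <= z <= 0 -> D z = 0).
assert (Zhalf : Z (1/2)).
{ split; [lra|]; intros z Hz; apply H0, Rabs_def1; lra. }
destruct (completeness Z) as [r0 [Hub Hlub]].
- exists (- x1); intros r [Hr0 Hr].
  apply Rnot_lt_le; intros Hlt; apply E, Hr; lra.
- exists (1/2); exact Zhalf.
- pose proof (Hub _ Zhalf) as Hr0.
  assert (Hz : forall z, - r0 < z <= 0 -> D z = 0).
  { intros z Hz.
    apply NNPP; intros Hne.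
    assert (r0 <= - z); [|lra].
    apply Hlub; intros r [Hr Hr'].
    apply Rnot_lt_le; intros Hlt; apply Hne, Hr'; lra. }
  destruct (Han (- r0)) as [u [d Hd]]; [lra|].
  pose proof (cond_pos d) as Hdp.
  assert (Hu : forall n, u n = 0).
  (* The bound [d] keeps [- r0 + h] inside the disk of the expansion, and [r0] keeps it below 0,
     where [D] is known to vanish. *)
  { intros n; apply (pseries_zero_right_coeff u (Rmin d r0) n).
    - apply Rmin_pos; lra.
    - intros h Hh.
      pose proof (Rmin_l d r0); pose proof (Rmin_r d r0).
      rewrite <- (Hz (- r0 + h)) by lra.
      replace h with (- r0 + h - - r0) at 1 by ring.
      apply Hd; change (Rabs (- r0 + h - - r0) < d).
      replace (- r0 + h - - r0) with h by ring.
      rewrite Rabs_pos_eq; lra. }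
  assert (Z (r0 + d / 2)).
  { split; [lra|]; intros z Hzr.
    destruct (Rlt_dec (- r0) z) as [Hc|Hc]; [apply Hz; lra|].
    assert (Hb : ball (- r0) d z).
    { change (Rabs (z - - r0) < d); apply Rabs_def1; lra. }
    apply Hd, is_pseries_unique in Hb; rewrite <- Hb.
    rewrite (PSeries_ext _ (fun _ => 0)) by exact Hu.
    apply PSeries_const_0. }
  pose proof (Hub _ H); lra.
Qed.

Lemma analytic_at_minus (F G : R -> R) (x : R) :
  analytic_at F x -> analytic_at G x -> analytic_at (fun y => F y - G y) x.
Proof.
intros [u Hu] [v Hv]; exists (PS_minus u v).
generalize (filter_and _ _ Hu Hv); apply filter_imp; intros y [Hy1 Hy2].
exact (is_pseries_minus _ _ _ _ _ Hy1 Hy2).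
Qed.

(** As [F] witnesses existence, [epsilon] returns some continuation; its difference with [F] is
    analytic and vanishes on the unit disk. *)
Lemma hyp2F1_unique (a b c : R) (F : R -> R) :
  continues_hyp2F1 a b c F -> forall x, x < 1 -> hyp2F1 a b c x = F x.
Proof.
intros HF x Hx.
assert (HH : continues_hyp2F1 a b c (hyp2F1 a b c)).
{ exact (epsilon_spec (inhabits (fun _ => 0)) _ (ex_intro _ F HF)). }
destruct HF as [HF1 HF2], HH as [HH1 HH2].
apply Rminus_diag_uniq.
apply (analytic_vanishing (fun y => hyp2F1 a b c y - F y)); [| |exact Hx].
- intros y Hy; apply analytic_at_minus; auto.
- intros y Hy.
  rewrite <- (is_pseries_unique _ _ _ (HH1 y Hy)).
  rewrite <- (is_pseries_unique _ _ _ (HF1 y Hy)); ring.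
Qed.

(** * Euler's integral for the hypergeometric function *)

(* [((1 - z)^-M - 1) / z], with its removable singularity at 0 filled in. *)
Fixpoint geom_kernel (M : nat) (z : R) : R :=
  match M with
  | O => 0
  | S m => (1 + geom_kernel m z) / (1 - z)
  end.

Lemma geom_kernel_mul (M : nat) (z : R) :
  z <> 1 -> z * geom_kernel M z = / (1 - z) ^ M - 1.
Proof.
intros Hz; induction M as [|M IH]; simpl; [field|].
assert (1 - z <> 0) by lra.
replace (z * ((1 + geom_kernel M z) / (1 - z)))
  with ((z + z * geom_kernel M z) / (1 - z)) by (field; lra).
rewrite IH; field; split; [apply pow_nonzero|]; lra.
Qed.

Lemma geom_kernel_0 (M : nat) : geom_kernel M 0 = INR M.
Proof.
induction M as [|M IH]; [reflexivity|].
rewrite S_INR; simpl; rewrite IH; field.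
Qed.

Lemma geom_kernel_pos (M : nat) (z : R) : z < 1 -> 0 <= geom_kernel M z.
Proof.
intros Hz; induction M as [|M IH]; simpl; [lra|].
apply Rdiv_le_0_compat; lra.
Qed.

Lemma continuous_geom_kernel (M : nat) (z : R) :
  z < 1 -> continuous (geom_kernel M) z.
Proof.
intros Hz; induction M as [|M IH]; simpl.
- apply continuous_const.
- apply (continuous_mult (fun z => 1 + geom_kernel M z) (fun z => / (1 - z))).
  + apply (continuous_plus (fun _ => 1)); [apply continuous_const|exact IH].
  + apply continuous_Rinv_comp; [|lra].
    apply (continuous_minus (fun _ => 1) (fun z => z));
      [apply continuous_const|apply continuous_id].
Qed.

(** * Taylor expansion of the kernel at 0 *)

Lemma pochhammer_S_left (a : R) (n : nat) :
  pochhammer a (S n) = a * pochhammer (a + 1) n.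
Proof.
induction n as [|n IH]; [simpl; ring|].
change (pochhammer a (S n) * (a + INR (S n)) =
        a * (pochhammer (a + 1) n * (a + 1 + INR n))).
rewrite IH, S_INR; ring.
Qed.

Lemma pochhammer_pos (a : R) (n : nat) : 0 < a -> 0 < pochhammer a n.
Proof.
intros Ha; induction n as [|n IH]; simpl; [lra|].
pose proof (pos_INR n); apply Rmult_lt_0_compat; lra.
Qed.

(** Binomial-series coefficients of [(1 - z)^-M], shifted by one because the kernel divides by
    [z]. *)
Definition geom_kernel_coeff (M n : nat) : R :=
  pochhammer (INR M) (S n) / INR (fact (S n)).

Lemma geom_kernel_coeff_pos (M n : nat) : 0 <= geom_kernel_coeff M n.
Proof.
apply Rdiv_le_0_compat; [|apply lt_0_INR, lt_O_fact].
destruct M as [|M].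
- rewrite pochhammer_S_left; simpl (INR 0); lra.
- apply Rlt_le, pochhammer_pos, lt_0_INR; lia.
Qed.

(** Pascal's rule; it is the coefficient form of [(1 - z) * geom_kernel (S M) z = 1 + geom_kernel M
    z]. *)
Lemma geom_kernel_coeff_S (M n : nat) :
  geom_kernel_coeff (S M) (S n) =
  geom_kernel_coeff (S M) n + geom_kernel_coeff M (S n).
Proof.
unfold geom_kernel_coeff.
rewrite (pochhammer_S_left (INR M)), <- S_INR.
rewrite (fact_simpl (S n)), mult_INR.
change (pochhammer (INR (S M)) (S (S n)))
  with (pochhammer (INR (S M)) (S n) * (INR (S M) + INR (S n))).
pose proof (INR_fact_neq_0 (S n)).
assert (INR (S (S n)) <> 0) by (apply not_0_INR; lia).
rewrite (S_INR M), (S_INR (S n)) in *; field; auto.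
Qed.

Lemma geom_kernel_pseries (M : nat) (z : R) :
  Rabs z < 1 -> is_pseries (geom_kernel_coeff M) z (geom_kernel M z).
Proof.
revert z; induction M as [|M IH]; intros z Hz.
- apply is_pseries_R.
  apply (is_series_ext (fun _ => 0)).
  { intros n; unfold geom_kernel_coeff.
    rewrite pochhammer_S_left; simpl (INR 0).
    unfold Rdiv; rewrite !Rmult_0_l; reflexivity. }
  apply (filterlim_ext (fun _ => 0)); [|apply filterlim_const].
  intros n; symmetry; apply (sum_n_m_const_zero (G := R_AbelianMonoid)).
(* [e] holds the coefficients of [1 + geom_kernel M]. The Cauchy product with the geometric series
   turns them into their partial sums, which Pascal's rule identifies. *)
- set (e := fun n => match n with
                     | O => 1 + geom_kernel_coeff M 0
                     | S k => geom_kernel_coeff M (S k)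
                     end).
  assert (He : forall y, Rabs y < 1 -> is_pseries e y (1 + geom_kernel M y)).
  { intros y Hy; apply is_pseries_R, is_series_decr_1.
    apply (is_series_incr_1 (fun n => geom_kernel_coeff M n * y ^ n)).
    replace (plus _ _) with (geom_kernel M y);
      [apply is_pseries_R, IH, Hy|].
    unfold plus, opp, e; simpl; ring. }
  assert (Hone : forall y, Rabs y < 1 ->
            is_pseries (fun _ => 1) y (/ (1 - y))).
  { intros y Hy; apply is_pseries_R.
    apply (is_series_ext (fun n => y ^ n)); [intros n; symmetry; apply Rmult_1_l|].
    apply is_series_geom, Hy. }
  apply (is_pseries_ext (PS_mult e (fun _ => 1))).
  + intros n; unfold PS_mult; induction n as [|n IHn].
    * unfold e, geom_kernel_coeff; rewrite S_INR; simpl; field.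
    * rewrite geom_kernel_coeff_S, <- IHn; simpl; ring.
  + apply is_pseries_mult; auto; apply CV_radius_unit_disk; auto;
      intros y Hy; eexists; apply is_pseries_R; auto.
Qed.

(** * Term-by-term integration of a dominated power series *)

Lemma partial_sum_dominated (c : nat -> R) (rho y : R) (n m : nat) :
  (forall k, 0 <= c k) -> Rabs y <= rho -> (n <= m)%nat ->
  Rabs (sum_n (fun k => c k * y ^ k) m - sum_n (fun k => c k * y ^ k) n) <=
  sum_n (fun k => c k * rho ^ k) m - sum_n (fun k => c k * rho ^ k) n.
Proof.
intros Hc Hy Hnm; induction Hnm as [|m Hnm IH].
- rewrite !Rminus_diag, Rabs_R0; lra.
- rewrite !sum_Sn; unfold plus; simpl.
  assert (Rabs (c (S m) * y ^ S m) <= c (S m) * rho ^ S m).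
  { rewrite Rabs_mult, (Rabs_pos_eq (c (S m))), <- RPow_abs by auto.
    apply Rmult_le_compat_l; [auto|]; apply pow_incr.
    split; [apply Rabs_pos|exact Hy]. }
  simpl in H.
  apply Rabs_le; apply Rabs_le_between in IH; apply Rabs_le_between in H; lra.
Qed.

(** Let [m] tend to infinity in [partial_sum_dominated]. The bound is free of [y], so convergence is
    uniform on [Rabs y <= rho]. *)
Lemma pseries_tail_dominated (c : nat -> R) (rho L y l : R) (n : nat) :
  (forall k, 0 <= c k) -> Rabs y <= rho ->
  is_pseries c rho L -> is_pseries c y l ->
  Rabs (l - sum_n (fun k => c k * y ^ k) n) <=
  L - sum_n (fun k => c k * rho ^ k) n.
Proof.
intros Hc Hy HL Hl.
apply is_pseries_R in HL; apply is_pseries_R in Hl.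
assert (Hl' : is_lim_seq (sum_n (fun k => c k * y ^ k)) l) by exact Hl.
assert (HL' : is_lim_seq (sum_n (fun k => c k * rho ^ k)) L) by exact HL.
apply (is_lim_seq_le_loc
  (fun m => Rabs (sum_n (fun k => c k * y ^ k) m - sum_n (fun k => c k * y ^ k) n))
  (fun m => sum_n (fun k => c k * rho ^ k) m - sum_n (fun k => c k * rho ^ k) n)
  (Rabs (l - sum_n (fun k => c k * y ^ k) n))
  (L - sum_n (fun k => c k * rho ^ k) n)).
- exists n; intros m Hm; apply partial_sum_dominated; auto.
- apply (is_lim_seq_abs _ (l - _)), is_lim_seq_minus';
    [exact Hl'|apply is_lim_seq_const].
- apply is_lim_seq_minus'; [exact HL'|apply is_lim_seq_const].
Qed.

Lemma ex_RInt_mul_pow (g zeta : R -> R) (n : nat) :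
  (forall s, 0 <= s <= 1 -> continuous g s /\ continuous zeta s) ->
  ex_RInt (fun s => g s * zeta s ^ n) 0 1.
Proof.
intros Hcont; apply (ex_RInt_continuous (V := R_CompleteNormedModule)).
intros s Hs; rewrite Rmin_left, Rmax_right in Hs by lra.
destruct (Hcont s Hs) as [Hg Hz].
apply (continuous_mult g (fun s => zeta s ^ n)); [exact Hg|].
induction n as [|n IH]; simpl; [apply continuous_const|].
apply (continuous_mult zeta (fun s => zeta s ^ n)); assumption.
Qed.

(** Integrating the partial sums [T n] of the integrand gives the partial sums of the claimed
    series. The integrands differ by at most [G] times the tail at [rho], uniformly in [s], so the
    integrals converge by squeezing. *)
Lemma is_pseries_RInt_comp (c : nat -> R) (phi g zeta : R -> R)
    (h rho L G : R) :
  (forall k, 0 <= c k) -> is_pseries c rho L ->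
  (forall y, Rabs y <= rho -> is_pseries c y (phi y)) ->
  (forall s, 0 <= s <= 1 -> continuous g s /\ continuous zeta s) ->
  (forall s, 0 <= s <= 1 -> Rabs (g s) <= G /\ Rabs (h * zeta s) <= rho) ->
  ex_RInt (fun s => g s * phi (h * zeta s)) 0 1 ->
  is_pseries (fun k => c k * RInt (fun s => g s * zeta s ^ k) 0 1) h
    (RInt (fun s => g s * phi (h * zeta s)) 0 1).
Proof.
intros Hc HL Hphi Hcont Hbd Hex.
set (T := fun n s => g s * sum_n (fun k => c k * (h * zeta s) ^ k) n).
assert (HT : forall n,
  is_RInt (T n) 0 1
    (sum_n (fun k => c k * RInt (fun s => g s * zeta s ^ k) 0 1 * h ^ k) n)).
{ assert (Hterm : forall k,
    is_RInt (fun s => g s * (c k * (h * zeta s) ^ k)) 0 1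
      (c k * RInt (fun s => g s * zeta s ^ k) 0 1 * h ^ k)).
  { intros k.
    pose proof (RInt_correct _ _ _ (ex_RInt_mul_pow g zeta k Hcont)) as H.
    apply (is_RInt_scal _ _ _ (c k * h ^ k)) in H.
    replace (c k * _ * h ^ k) with
      (scal (c k * h ^ k) (RInt (fun s => g s * zeta s ^ k) 0 1))
      by (unfold scal; simpl; unfold mult; simpl; ring).
    apply (is_RInt_ext (V := R_NormedModule)) with (2 := H).
    intros s _; unfold scal; simpl; unfold mult; simpl.
    rewrite Rpow_mult_distr; ring. }
  induction n as [|n IHn]; unfold T in *.
  - rewrite sum_O.
    apply (is_RInt_ext (V := R_NormedModule)) with (2 := Hterm 0%nat).
    intros s _; rewrite sum_O; reflexivity.
  - rewrite sum_Sn.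
    apply (is_RInt_ext (V := R_NormedModule))
      with (2 := is_RInt_plus _ _ _ _ _ _ IHn (Hterm (S n))).
    intros s _; rewrite sum_Sn; unfold plus; simpl; ring. }
apply is_pseries_R.
set (I := RInt (fun s => g s * phi (h * zeta s)) 0 1).
set (P := sum_n (fun k => c k * RInt (fun s => g s * zeta s ^ k) 0 1 * h ^ k)).
set (E := fun n => G * (L - sum_n (fun k => c k * rho ^ k) n)).
assert (HE : is_lim_seq E 0).
{ replace (Finite 0) with (Rbar_mult G (L - L)) by
    (rewrite Rminus_diag; simpl; rewrite Rmult_0_r; reflexivity).
  apply is_lim_seq_scal_l, is_lim_seq_minus'; [apply is_lim_seq_const|].
  apply is_pseries_R in HL; exact HL. }
assert (Hdiff : forall n, Rabs (I - P n) <= E n).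
{ intros n.
  rewrite <- (is_RInt_unique _ _ _ _ (HT n) : _ = P n).
  unfold I.
  pose proof (RInt_minus _ (T n) 0 1 Hex (ex_intro _ _ (HT n))) as H.
  unfold minus, plus, opp in H; simpl in H.
  unfold Rminus; rewrite <- H.
  replace (E n) with ((1 - 0) * E n) by ring.
  apply abs_RInt_le_const; [lra| |].
  - apply (ex_RInt_minus (V := R_NormedModule)); [exact Hex|eexists; apply HT].
  - intros s Hs; destruct (Hbd s Hs) as [HG Hr].
    unfold T, E.
    replace (_ + - _) with
      (g s * (phi (h * zeta s) - sum_n (fun k => c k * (h * zeta s) ^ k) n))
      by ring.
    rewrite Rabs_mult; apply Rmult_le_compat; try apply Rabs_pos; [exact HG|].
    apply pseries_tail_dominated; auto. }
change (is_lim_seq P I).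
apply (is_lim_seq_le_le (fun n => I - E n) P (fun n => I + E n)).
- intros n; specialize (Hdiff n); apply Rabs_le_between in Hdiff; lra.
- replace I with (I - 0) at 1 by ring.
  apply is_lim_seq_minus'; [apply is_lim_seq_const|exact HE].
- replace I with (I + 0) at 1 by ring.
  apply is_lim_seq_plus'; [apply is_lim_seq_const|exact HE].
Qed.

(* Recentring at [x0]: [(1 - x0 w) (1 - h w / (1 - x0 w)) = 1 - (x0 + h) w]. *)
Lemma geom_kernel_recentre (M : nat) (x0 h w : R) :
  x0 * w < 1 -> (x0 + h) * w < 1 ->
  (x0 + h) * geom_kernel M ((x0 + h) * w) =
  x0 * geom_kernel M (x0 * w) +
  h * (/ (1 - x0 * w) ^ S M * geom_kernel M (h * (w / (1 - x0 * w)))).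
Proof.
intros H0 H1.
assert (N0 : 1 - x0 * w <> 0) by lra.
destruct (Req_dec w 0) as [->|Hw].
- rewrite !Rmult_0_r, Rminus_0_r, pow1.
  unfold Rdiv; rewrite Rmult_0_l, Rmult_0_r, !geom_kernel_0, Rinv_1; ring.
- apply (Rmult_eq_reg_l w); [|exact Hw].
  set (z := h * (w / (1 - x0 * w))).
  assert (Hz : 1 - (x0 + h) * w = (1 - x0 * w) * (1 - z)).
  { unfold z; field; exact N0. }
  assert (Nz : z <> 1).
  { intros E; rewrite E in Hz; lra. }
  assert (Hhw : h * w = (1 - x0 * w) * z) by (unfold z; field; exact N0).
  replace (w * ((x0 + h) * _)) with
    ((x0 + h) * w * geom_kernel M ((x0 + h) * w)) by ring.
  replace (w * (x0 * _ + _)) with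
    (x0 * w * geom_kernel M (x0 * w) +
     h * w * / (1 - x0 * w) ^ S M * geom_kernel M z) by ring.
  rewrite Hhw, !geom_kernel_mul by lra.
  replace ((1 - x0 * w) * z * / (1 - x0 * w) ^ S M * geom_kernel M z) with
    ((1 - x0 * w) * / (1 - x0 * w) ^ S M * (z * geom_kernel M z)) by ring.
  rewrite geom_kernel_mul, Hz, Rpow_mult_distr by exact Nz.
  assert (1 - z <> 0) by lra.
  simpl; field.
  repeat split; try apply pow_nonzero; assumption.
Qed.

(** * Analyticity of a weighted integral of the kernel *)

Definition unit_weight (w : R -> R) : Prop :=
  forall s, 0 <= s <= 1 -> continuous w s /\ 0 <= w s <= 1.

(** [1 - x * w s] lies between the values 1 and [1 - x] that it takes at weights 0 and 1. The lower
    bound, uniform in [s], also serves as a radius of convergence at [x]. *)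
Lemma unit_weight_mul_lt (w : R -> R) (x s : R) :
  unit_weight w -> x < 1 -> 0 <= s <= 1 -> Rmin 1 (1 - x) <= 1 - x * w s.
Proof.
intros Hw Hx Hs; destruct (Hw s Hs) as [_ H].
destruct (Rle_dec 0 x).
- eapply Rle_trans; [apply Rmin_r|]; nra.
- eapply Rle_trans; [apply Rmin_l|]; nra.
Qed.

Lemma continuous_mul_const (w : R -> R) (x s : R) :
  continuous w s -> continuous (fun t => x * w t) s.
Proof.
intros H; apply (continuous_mult (fun _ => x)); [apply continuous_const|exact H].
Qed.

Lemma continuous_one_minus_mul (w : R -> R) (x s : R) :
  continuous w s -> continuous (fun t => 1 - x * w t) s.
Proof.
intros H; apply (continuous_minus (fun _ => 1) (fun t => x * w t));
  [apply continuous_const|apply continuous_mul_const, H].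
Qed.

Lemma ex_RInt_geom_kernel (M : nat) (w : R -> R) (x : R) :
  unit_weight w -> x < 1 -> ex_RInt (fun s => geom_kernel M (x * w s)) 0 1.
Proof.
intros Hw Hx; apply (ex_RInt_continuous (V := R_CompleteNormedModule)).
intros s Hs; rewrite Rmin_left, Rmax_right in Hs by lra.
apply (continuous_comp (fun s => x * w s) (geom_kernel M)).
- apply continuous_mul_const, Hw, Hs.
- apply continuous_geom_kernel.
  pose proof (unit_weight_mul_lt w x s Hw Hx Hs).
  assert (0 < Rmin 1 (1 - x)) by (apply Rmin_pos; lra); lra.
Qed.

(** Where [w] is nonzero, [x] times the integrand is [((1 - x w)^-M - 1) / w]; the kernel avoids
    dividing by a weight that may vanish. *)
Definition weight_transform (M : nat) (w : R -> R) (x : R) : R :=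
  x * RInt (fun s => geom_kernel M (x * w s)) 0 1.

Definition weight_transform_coeff (M : nat) (w : R -> R) (x0 : R) (k : nat) : R :=
  geom_kernel_coeff M k *
  RInt (fun s => / (1 - x0 * w s) ^ S M * (w s / (1 - x0 * w s)) ^ k) 0 1.

(** Integrate [geom_kernel_recentre] over [s]: its first term gives the transform at [x0], and its
    second, expanded in [h] under the integral, gives [h * l]. *)
Lemma weight_transform_pseries (M : nat) (w : R -> R) (x0 h : R) :
  unit_weight w -> x0 < 1 -> Rabs h < Rmin 1 (1 - x0) ->
  exists l, is_pseries (weight_transform_coeff M w x0) h l /\
    weight_transform M w (x0 + h) = weight_transform M w x0 + h * l.
Proof.
intros Hw Hx0 Hh.
(* [m] bounds [1 - x0 * w s] from below, so [Rabs (h * zeta s) <= Rabs h / m < 1] for all [s], and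
   [g] is at most [/ m ^ S M]. *)
set (m := Rmin 1 (1 - x0)) in *.
assert (Hm : 0 < m) by (apply Rmin_pos; lra).
assert (Hx1 : x0 + h < 1).
{ pose proof (Rmin_r 1 (1 - x0)); fold m in H.
  apply Rabs_def2 in Hh; lra. }
pose proof (Rabs_pos h) as Hh0.
assert (Hrho : Rabs h / m < 1) by (apply Rlt_div_l; lra).
assert (Hrho0 : 0 <= Rabs h / m) by (apply Rdiv_le_0_compat; lra).
set (g := fun s => / (1 - x0 * w s) ^ S M).
set (zeta := fun s => w s / (1 - x0 * w s)).
assert (Hb : forall s, 0 <= s <= 1 -> Rabs (h * zeta s) <= Rabs h / m).
{ intros s Hs; pose proof (unit_weight_mul_lt w x0 s Hw Hx0 Hs) as H.
  fold m in H; destruct (Hw s Hs) as [_ Hws].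
  rewrite Rabs_mult; apply Rmult_le_compat_l; [exact Hh0|].
  rewrite Rabs_pos_eq by (apply Rdiv_le_0_compat; lra).
  unfold zeta, Rdiv; rewrite <- (Rmult_1_l (/ m)).
  apply Rmult_le_compat; try lra.
  - apply Rlt_le, Rinv_0_lt_compat; lra.
  - apply Rinv_le_contravar; lra. }
assert (Hc : forall s, 0 <= s <= 1 -> continuous g s /\ continuous zeta s).
{ intros s Hs; pose proof (unit_weight_mul_lt w x0 s Hw Hx0 Hs) as H.
  fold m in H; destruct (Hw s Hs) as [Hcw _].
  pose proof (continuous_one_minus_mul w x0 s Hcw) as Hd.
  split.
  - apply continuous_Rinv_comp; [|apply pow_nonzero; lra].
    generalize (S M); intros n; induction n as [|n IH]; simpl;
      [apply continuous_const|].
    apply (continuous_mult (fun t => 1 - x0 * w t)); assumption.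
  - apply (continuous_mult w); [exact Hcw|].
    apply continuous_Rinv_comp; [exact Hd|lra]. }
assert (Hex : ex_RInt (fun s => g s * geom_kernel M (h * zeta s)) 0 1).
{ apply (ex_RInt_continuous (V := R_CompleteNormedModule)).
  intros s Hs; rewrite Rmin_left, Rmax_right in Hs by lra.
  destruct (Hc s Hs) as [Hg Hz].
  apply (continuous_mult g); [exact Hg|].
  apply (continuous_comp (fun s => h * zeta s) (geom_kernel M)).
  - apply continuous_mul_const, Hz.
  - apply continuous_geom_kernel.
    specialize (Hb s Hs); apply Rabs_le_between in Hb; lra. }
exists (RInt (fun s => g s * geom_kernel M (h * zeta s)) 0 1); split.
- apply (is_pseries_RInt_comp _ _ g zeta h (Rabs h / m)
           (geom_kernel M (Rabs h / m)) (/ m ^ S M)); auto.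
  + apply geom_kernel_coeff_pos.
  + apply geom_kernel_pseries; rewrite Rabs_pos_eq; lra.
  + intros y Hy; apply geom_kernel_pseries; lra.
  + intros s Hs; split; [|apply Hb, Hs].
    pose proof (unit_weight_mul_lt w x0 s Hw Hx0 Hs) as H; fold m in H.
    assert (0 < m ^ S M) by (apply pow_lt; lra).
    assert (m ^ S M <= (1 - x0 * w s) ^ S M) by (apply pow_incr; lra).
    unfold g; rewrite Rabs_pos_eq.
    * apply Rinv_le_contravar; lra.
    * apply Rlt_le, Rinv_0_lt_compat; lra.
- unfold weight_transform.
  pose proof (ex_RInt_geom_kernel M w x0 Hw Hx0) as E0.
  pose proof (ex_RInt_geom_kernel M w (x0 + h) Hw Hx1) as E1.
  pose proof (is_RInt_scal _ _ _ x0 _ (RInt_correct _ _ _ E0)) as I0.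
  pose proof (is_RInt_scal _ _ _ (x0 + h) _ (RInt_correct _ _ _ E1)) as I1.
  pose proof (is_RInt_scal _ _ _ h _ (RInt_correct _ _ _ Hex)) as I2.
  pose proof (is_RInt_plus _ _ _ _ _ _ I0 I2) as E.
  apply (is_RInt_ext (V := R_NormedModule) _
    (fun s => scal (x0 + h) (geom_kernel M ((x0 + h) * w s)))) in E.
  + exact (eq_trans
      (eq_sym (is_RInt_unique (V := R_CompleteNormedModule) _ _ _ _ I1))
      (is_RInt_unique (V := R_CompleteNormedModule) _ _ _ _ E)).
  + intros s Hs; rewrite Rmin_left, Rmax_right in Hs by lra.
    assert (Hs' : 0 <= s <= 1) by lra.
    symmetry; apply geom_kernel_recentre.
    * pose proof (unit_weight_mul_lt w x0 s Hw Hx0 Hs'); fold m in H; lra.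
    * pose proof (unit_weight_mul_lt w (x0 + h) s Hw Hx1 Hs').
      assert (0 < Rmin 1 (1 - (x0 + h))) by (apply Rmin_pos; lra); lra.
Qed.

(** The factor [h] before [l] shifts the coefficients by one. At [x0 = 0] this yields Gauss's
    series, at other centres analyticity. *)
Lemma affine_weight_transform_pseries (M : nat) (w : R -> R) (kappa x0 h : R) :
  unit_weight w -> x0 < 1 -> Rabs h < Rmin 1 (1 - x0) ->
  is_pseries
    (fun n => match n with
              | O => 1 - kappa * weight_transform M w x0
              | S k => - kappa * weight_transform_coeff M w x0 k
              end) h (1 - kappa * weight_transform M w (x0 + h)).
Proof.
intros Hw Hx0 Hh.
destruct (weight_transform_pseries M w x0 h Hw Hx0 Hh) as [l [Hl ->]].
apply is_pseries_R, is_series_decr_1.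
apply is_pseries_R in Hl; apply (is_series_scal_r (- kappa * h)) in Hl.
replace (plus _ _) with (l * (- kappa * h)).
- apply is_series_ext with (2 := Hl); intros n; simpl.
  replace (h * h ^ n) with (h ^ n * h) by ring; ring_simplify.
  reflexivity.
- unfold plus, opp; simpl; ring.
Qed.

(** * The power weight and its moments *)

(** The case split is for continuity at 0: since [ln] is 0 on nonpositive reals, [Rpower] alone
    would give 1 there. *)
Definition power_weight (p s : R) : R :=
  if Rlt_dec 0 s then Rpower s p else 0.

Lemma power_weight_pos (p s : R) : 0 < s -> power_weight p s = Rpower s p.
Proof. intros Hs; unfold power_weight; destruct (Rlt_dec 0 s); lra. Qed.

(** For [0 < s <= 1], [ln s <= 0] and hence [p * ln s <= ln s]. Negative [s] is included to get
    continuity at 0 from both sides. *)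
Lemma power_weight_le (p s : R) :
  1 <= p -> s <= 1 -> 0 <= power_weight p s <= Rabs s.
Proof.
intros Hp Hs; unfold power_weight; destruct (Rlt_dec 0 s) as [H|H].
- rewrite Rabs_pos_eq by lra; split; [apply Rlt_le, exp_pos|].
  rewrite <- (exp_ln s) at 2 by exact H.
  assert (ln s <= 0) by (rewrite <- ln_1; apply ln_le; lra).
  assert (p * ln s <= ln s) by nra.
  unfold Rpower; destruct H1 as [H1| ->]; [left; apply exp_increasing, H1|lra].
- split; [lra|apply Rabs_pos].
Qed.

Lemma power_weight_unit (p : R) : 1 <= p -> unit_weight (power_weight p).
Proof.
intros Hp s Hs; split.
- destruct (Req_dec s 0) as [->|Hs0].
  + assert (H0 : power_weight p 0 = 0).
    { unfold power_weight; destruct (Rlt_dec 0 0); lra. }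
    apply filterlim_locally; intros eps; rewrite H0.
    pose proof (cond_pos eps).
    exists (mkposreal (Rmin eps 1) (Rmin_pos _ _ H Rlt_0_1)).
    intros y Hy; change (Rabs (y - 0) < Rmin eps 1) in Hy.
    change (Rabs (power_weight p y - 0) < eps).
    rewrite Rminus_0_r in Hy; rewrite Rminus_0_r.
    pose proof (Rmin_l eps 1); pose proof (Rmin_r eps 1).
    pose proof (Rle_abs y).
    pose proof (power_weight_le p y Hp ltac:(lra)).
    rewrite Rabs_pos_eq; lra.
  + apply (continuous_ext_loc _ (fun t => Rpower t p)).
    * assert (Hpos : 0 < s) by lra.
      exists (mkposreal s Hpos); intros y Hy.
      change (Rabs (y - s) < s) in Hy; apply Rabs_def2 in Hy.
      symmetry; apply power_weight_pos; lra.
    * apply (ex_derive_continuous (V := R_NormedModule)).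
      unfold Rpower; auto_derive; lra.
- pose proof (power_weight_le p s Hp ltac:(lra)).
  rewrite Rabs_pos_eq in H by lra; lra.
Qed.

(** The difference quotient at 0 is [g] itself. This handles the endpoint 0 of the moment integral,
    where [ln] cannot be differentiated. *)
Lemma is_derive_id_mul_0 (g : R -> R) :
  continuous g 0 -> is_derive (fun s => s * g s) 0 (g 0).
Proof.
intros Hg; apply is_derive_Reals; intros eps Heps.
destruct (proj1 (filterlim_locally _ _) Hg (mkposreal _ Heps)) as [d Hd].
exists d; intros h Hh0 Hh.
replace (((0 + h) * g (0 + h) - 0 * g 0) / h - g 0) with (g (0 + h) - g 0)
  by (field; exact Hh0).
apply (Hd (0 + h)); change (Rabs (0 + h - 0) < d).
replace (0 + h - 0) with h by ring; exact Hh.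
Qed.

Lemma power_weight_moment (p : R) (n : nat) :
  1 <= p -> RInt (fun s => power_weight p s ^ n) 0 1 = / (p * INR n + 1).
Proof.
intros Hp; set (q := p * INR n + 1).
assert (Hq : 0 < q) by (pose proof (pos_INR n); unfold q; nra).
assert (Hpow : forall s, 0 < s -> power_weight p s ^ n = exp (q * ln s) / s).
{ intros s Hs; rewrite power_weight_pos, <- Rpower_pow, Rpower_mult
    by (try exact Hs; apply exp_pos).
  unfold q; rewrite Rmult_plus_distr_r, exp_plus, Rmult_1_l, exp_ln by exact Hs.
  unfold Rpower; field; lra. }
assert (Hc : forall s, 0 <= s <= 1 -> continuous (fun s => power_weight p s ^ n) s).
{ intros s Hs; generalize n; intros k; induction k as [|k IH]; simpl;
    [apply continuous_const|].
  apply (continuous_mult (power_weight p));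
    [apply power_weight_unit; assumption|exact IH]. }
apply is_RInt_unique.
replace (/ q) with
  (minus (/ q * (1 * power_weight p 1 ^ n)) (/ q * (0 * power_weight p 0 ^ n))).
- apply (is_RInt_derive (V := R_CompleteNormedModule)
    (fun s => / q * (s * power_weight p s ^ n)));
    intros s Hs; rewrite Rmin_left, Rmax_right in Hs by lra; [|apply Hc, Hs].
  destruct (Req_dec s 0) as [->|Hs0].
  (* The factor [/ q] is harmless at 0: the power is 0 for [n > 0], and [q = 1] for [n = 0]. *)
  + replace (power_weight p 0 ^ n) with (/ q * power_weight p 0 ^ n).
    * apply (is_derive_scal (fun s => s * power_weight p s ^ n)).
      apply (is_derive_id_mul_0 (fun s => power_weight p s ^ n)), Hc; lra.
    * unfold power_weight; destruct (Rlt_dec 0 0); [lra|].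
      destruct n as [|n]; [|simpl; ring].
      unfold q; simpl; field.
  + assert (Hpos : 0 < s) by lra.
    rewrite Hpow by exact Hpos.
    apply (is_derive_ext_loc (fun s => / q * exp (q * ln s))).
    * exists (mkposreal s Hpos); intros y Hy.
      change (Rabs (y - s) < s) in Hy; apply Rabs_def2 in Hy.
      rewrite Hpow by lra.
      match goal with |- ?l = ?r => change (@eq R l r) end; field; lra.
    * auto_derive; [exact Hpos|]; field; lra.
- rewrite Hpow, ln_1, Rmult_0_r, exp_0 by lra.
  unfold minus, plus, opp; simpl; field; lra.
Qed.

(* Substituting [t = s^(1/(1 - beta))] in Euler's integral
   [1 - beta int_0^1 t^(-beta-1) ((1 - x t)^(-M) - 1) dt] removes the
   singularity of the integrand at 0. *)
Definition hyp2F1_integral (beta : R) (M : nat) (x : R) : R :=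
  1 - beta / (1 - beta) * weight_transform M (power_weight (/ (1 - beta))) x.

Lemma inv_one_minus_ge_1 (beta : R) : 0 < beta < 1 -> 1 <= / (1 - beta).
Proof.
intros Hb; rewrite <- Rinv_1; apply Rinv_le_contravar; lra.
Qed.

(** At centre 0 the moment formula contributes [- beta / (1 - beta + n)] to the coefficient of index
    [n + 1], which is the quotient of the Pochhammer symbols of [- beta] and [1 - beta]. Other
    centres [x0] give analyticity with radius [Rmin 1 (1 - x0)]. *)
Lemma hyp2F1_integral_continues (beta : R) (M : nat) :
  0 < beta < 1 ->
  continues_hyp2F1 (- beta) (INR M) (1 - beta) (hyp2F1_integral beta M).
Proof.
intros Hb.
pose proof (inv_one_minus_ge_1 beta Hb) as Hp.
pose proof (power_weight_unit _ Hp) as Hw.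
split.
- intros x Hx.
  pose proof (affine_weight_transform_pseries M _ (beta / (1 - beta)) 0 x Hw
    ltac:(lra)) as H.
  rewrite Rminus_0_r, Rmin_left, Rplus_0_l in H by lra; specialize (H Hx).
  apply is_pseries_ext with (2 := H); intros [|n].
  + unfold weight_transform, hyp2F1_coeff; simpl (pochhammer _ 0).
    rewrite Rmult_0_l; change (INR (fact 0)) with 1.
    match goal with |- ?l = ?r => change (@eq R l r) end; field; lra.
  + unfold weight_transform_coeff, hyp2F1_coeff, geom_kernel_coeff.
    rewrite (RInt_ext _ (fun s => power_weight (/ (1 - beta)) s ^ n)).
    2:{ intros s _; rewrite Rmult_0_l, Rminus_0_r, pow1, Rinv_1.
        unfold Rdiv; rewrite Rinv_1, Rmult_1_r, Rmult_1_l; reflexivity. }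
    rewrite power_weight_moment by exact Hp.
    rewrite (pochhammer_S_left (- beta)).
    replace (- beta + 1) with (1 - beta) by ring.
    change (pochhammer (1 - beta) (S n))
      with (pochhammer (1 - beta) n * (1 - beta + INR n)).
    pose proof (pochhammer_pos (1 - beta) n ltac:(lra)).
    pose proof (pos_INR n); pose proof (INR_fact_neq_0 (S n)).
    match goal with |- ?l = ?r => change (@eq R l r) end.
    field; repeat split; try lra; auto.
- intros x0 Hx0; eexists.
  assert (Hm : 0 < Rmin 1 (1 - x0)) by (apply Rmin_pos; lra).
  exists (mkposreal _ Hm); intros y Hy.
  change (Rabs (y - x0) < Rmin 1 (1 - x0)) in Hy.
  pose proof (affine_weight_transform_pseries M _ (beta / (1 - beta)) x0 (y - x0)
    Hw Hx0 Hy) as H.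
  rewrite Rplus_minus in H; exact H.
Qed.

(** For [x <= 0] the kernel is nonnegative, so the transform is nonpositive, and it enters with a
    negative factor. *)
Lemma hyp2F1_ge_1 (beta : R) (M : nat) (x : R) :
  0 < beta < 1 -> x <= 0 -> 1 <= hyp2F1 (- beta) (INR M) (1 - beta) x.
Proof.
intros Hb Hx.
rewrite (hyp2F1_unique _ _ _ _ (hyp2F1_integral_continues beta M Hb)) by lra.
unfold hyp2F1_integral, weight_transform.
set (w := power_weight (/ (1 - beta))).
assert (Hw : unit_weight w).
{ apply power_weight_unit, inv_one_minus_ge_1, Hb. }
assert (HI : 0 <= RInt (fun s => geom_kernel M (x * w s)) 0 1).
{ apply RInt_ge_0; [lra|apply ex_RInt_geom_kernel; [exact Hw|lra]|].
  intros s Hs; apply geom_kernel_pos.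
  destruct (Hw s ltac:(lra)) as [_ H]; nra. }
assert (0 < beta / (1 - beta)) by (apply Rdiv_lt_0_compat; lra).
assert (x * RInt (fun s => geom_kernel M (x * w s)) 0 1 <= 0) by nra.
nra.
Qed.

(** * Limits and optimization *)

Lemma sum_n_m_1_S (x : nat -> R) (n : nat) :
  sum_n_m x 1 (S n) = sum_n_m x 1 n + x (S n).
Proof. apply (sum_n_Sm (G := R_AbelianMonoid)); lia. Qed.

Lemma sum_n_m_1_0 (x : nat -> R) : sum_n_m x 1 0 = 0.
Proof. apply (sum_n_m_zero (G := R_AbelianMonoid)); lia. Qed.

Lemma sum_n_m_1_le (x y : nat -> R) (n : nat) :
  (forall k, (1 <= k <= n)%nat -> x k <= y k) ->
  sum_n_m x 1 n <= sum_n_m y 1 n.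
Proof.
induction n as [|n IH]; intros H; [rewrite !sum_n_m_1_0; lra|].
rewrite !sum_n_m_1_S; apply Rplus_le_compat; [|apply H; lia].
apply IH; intros k Hk; apply H; lia.
Qed.

(** Used for uniqueness: a competitor with the same total Lagrangian must agree with the optimum
    file by file. *)
Lemma sum_n_m_1_le_eq (x y : nat -> R) (n : nat) :
  (forall k, (1 <= k <= n)%nat -> x k <= y k) ->
  sum_n_m y 1 n <= sum_n_m x 1 n ->
  forall k, (1 <= k <= n)%nat -> x k = y k.
Proof.
induction n as [|n IH]; intros H Hs k Hk; [lia|].
rewrite !sum_n_m_1_S in Hs.
assert (Hn : forall j, (1 <= j <= n)%nat -> x j <= y j).
{ intros j Hj; apply H; lia. }
pose proof (sum_n_m_1_le _ _ _ Hn).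
pose proof (H (S n) ltac:(lia)).
destruct (Nat.eq_dec k (S n)) as [->|Hkn]; [lra|].
apply IH; [exact Hn|lra|lia].
Qed.

Lemma filterlim_sum_n_m_1 {T : Type} {F : (T -> Prop) -> Prop} {FF : Filter F}
    (x : T -> nat -> R) (l : nat -> R) (n : nat) :
  (forall k, (1 <= k <= n)%nat -> filterlim (fun t => x t k) F (locally (l k))) ->
  filterlim (fun t => sum_n_m (x t) 1 n) F (locally (sum_n_m l 1 n)).
Proof.
induction n as [|n IH]; intros H.
- rewrite sum_n_m_1_0.
  apply (filterlim_ext (fun _ => 0)); [|apply filterlim_const].
  intros t; symmetry; apply sum_n_m_1_0.
- rewrite sum_n_m_1_S.
  apply (filterlim_ext (fun t => sum_n_m (x t) 1 n + x t (S n)));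
    [intros t; symmetry; apply sum_n_m_1_S|].
  apply (filterlim_comp_2 (G := locally (sum_n_m l 1 n)) (H := locally (l (S n)))).
  + apply IH; intros k Hk; apply H; lia.
  + apply H; lia.
  + apply (filterlim_plus (V := R_NormedModule)).
Qed.

Lemma finite_upper_bound (x : nat -> R) (n : nat) :
  exists B, 0 <= B /\ forall k, (1 <= k <= n)%nat -> x k <= B.
Proof.
induction n as [|n [B [HB H]]].
- exists 0; split; [lra|lia].
- exists (Rmax B (x (S n))); split.
  + eapply Rle_trans; [exact HB|apply Rmax_l].
  + intros k Hk; destruct (Nat.eq_dec k (S n)) as [->|]; [apply Rmax_r|].
    eapply Rle_trans; [apply H; lia|apply Rmax_l].
Qed.

Lemma clip01_bounds (x : R) : 0 <= clip01 x <= 1.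
Proof.
unfold clip01, Rmax, Rmin.
destruct (Rle_dec x 1); match goal with |- context [Rle_dec ?a ?b] =>
  destruct (Rle_dec a b) end; lra.
Qed.

Lemma clip01_lipschitz (x y : R) : Rabs (clip01 x - clip01 y) <= Rabs (x - y).
Proof.
unfold clip01, Rmax, Rmin, Rabs.
destruct (Rle_dec x 1), (Rle_dec y 1); repeat match goal with
  | |- context [Rle_dec ?a ?b] => destruct (Rle_dec a b)
  | |- context [Rcase_abs ?a] => destruct (Rcase_abs a)
  end; lra.
Qed.

Lemma continuous_clip01 (x : R) : continuous clip01 x.
Proof.
apply filterlim_locally; intros eps; exists eps; intros y Hy.
exact (Rle_lt_trans _ _ _ (clip01_lipschitz y x) Hy).
Qed.

(* Writing [q0 = clip01 (r - C)] and [p = nu r^2 / C], the difference of the two sides without the last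
   term is [nu (q0 - q) (r^2 - (C + q0) (C + q)) / ((C + q0) (C + q))]. *)
Lemma lagrangian_gap (C nu p q : R) :
  0 < C -> 0 < nu -> 0 < p -> 0 <= q <= 1 ->
  let q0 := clip01 (sqrt (C / nu) * sqrt p - C) in
  p * q / (C + q) - nu * q + nu * (q0 - q) ^ 2 / (C + q) <=
  p * q0 / (C + q0) - nu * q0.
Proof.
intros HC Hnu Hp Hq q0.
assert (HCnu : 0 < C / nu) by (apply Rdiv_lt_0_compat; lra).
set (r := sqrt (C / nu) * sqrt p) in q0.
assert (Hr : 0 < r) by (apply Rmult_lt_0_compat; apply sqrt_lt_R0; lra).
assert (Hpr : p = nu * r ^ 2 / C).
{ replace (r ^ 2) with ((sqrt (C / nu) * sqrt (C / nu)) * (sqrt p * sqrt p))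
    by (unfold r; ring).
  rewrite !sqrt_sqrt by lra; field; lra. }
assert (Hq0 : 0 <= q0 <= 1) by apply clip01_bounds.
assert (Hkey : (C + q0) * (q0 - q) ^ 2 <= (q0 - q) * (r ^ 2 - (C + q0) * (C + q))).
(* Clipped below, clipped above, or interior. In the interior case the inequality is an equality. *)
{ assert (Hcases : q0 = 0 /\ r <= C \/ q0 = 1 /\ C + 1 <= r \/ r = C + q0).
  { unfold q0, clip01, Rmax, Rmin.
    destruct (Rle_dec (r - C) 1); match goal with |- context [Rle_dec ?a ?b] =>
      destruct (Rle_dec a b) end; lra. }
  destruct Hcases as [[E H]|[[E H]|E]].
  - rewrite E; assert (r ^ 2 <= C ^ 2) by (apply pow_incr; lra); nra.
  - rewrite E; assert ((C + 1) ^ 2 <= r ^ 2) by (apply pow_incr; lra); nra.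
  - rewrite E; right; ring. }
apply Rminus_le_0.
replace (_ - _) with
  (nu * ((q0 - q) * (r ^ 2 - (C + q0) * (C + q)) - (C + q0) * (q0 - q) ^ 2) /
   ((C + q0) * (C + q))) by (rewrite Hpr; field; lra).
apply Rdiv_le_0_compat; [|apply Rmult_lt_0_compat; lra].
apply Rmult_le_pos; lra.
Qed.

(** * Positivity of the model constants *)

Lemma popularity_pos (s : network) (f : nat) :
  (1 <= Nf s)%nat -> 0 < popularity s f.
Proof.
intros HN; apply Rdiv_lt_0_compat; [apply exp_pos|].
unfold sum_files; induction HN as [|n Hn IH].
- rewrite sum_n_m_1_S, sum_n_m_1_0, Rplus_0_l; apply exp_pos.
- rewrite sum_n_m_1_S; apply Rplus_lt_0_compat; [exact IH|apply exp_pos].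
Qed.

Lemma C1_pos (s : network) : admissible s -> 0 < C1 s.
Proof.
intros [[Hl1 [Hl2 _]] [_ [[HB1 HB2] [Hg [Ha [HM1 [HM2 _]]]]]]].
assert (Hbeta : 0 < 2 / alpha s < 1).
{ split; [apply Rdiv_lt_0_compat; lra|apply Rlt_div_l; lra]. }
assert (Hx : 0 < gamma0 s / (M12 s * B12 s)).
{ apply Rdiv_lt_0_compat; [exact Hg|apply Rmult_lt_0_compat].
  - unfold M12; rewrite HM2; apply Rdiv_lt_0_compat; apply lt_0_INR; lia.
  - apply Rdiv_lt_0_compat; lra. }
pose proof (hyp2F1_ge_1 (2 / alpha s) (M1 s) (- (gamma0 s / (M12 s * B12 s)))
  Hbeta ltac:(lra)).
unfold C1; apply Rmult_lt_0_compat; [apply Rmult_lt_0_compat|lra].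
- apply Rdiv_lt_0_compat; lra.
- apply exp_pos.
Qed.

Lemma admissible_files (s : network) :
  admissible s -> (1 <= Nc s <= Nf s)%nat.
Proof. unfold admissible; tauto. Qed.

Lemma admissible_lam12_pos (s : network) : admissible s -> 0 < lam12 s.
Proof. intros [[H1 [H2 _]] _]; apply Rdiv_lt_0_compat; assumption. Qed.

(** * The limit of low user density *)

Lemma user_ratio_lim (s : network) :
  filterlim (fun t => lamu t / lam2 t) (low_user_density s) (locally 0).
Proof.
intros P [eps HP]; exists eps; intros l1 l2 lu H1 H2 Hu _ Hr; apply HP.
change (Rabs (lu / l2 - 0) < eps).
rewrite Rminus_0_r, Rabs_pos_eq; [exact Hr|].
apply Rlt_le, Rdiv_lt_0_compat; assumption.
Qed.

(** With [lam12] fixed, [pa2] depends on the densities only through [lamu / lam2], as a function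
    [phi] that is continuous at 0 with [phi 0 = 0]. *)
Lemma pa2_lim (s : network) (q : nat -> R) :
  admissible s ->
  filterlim (fun t => pa2 t q) (low_user_density s) (locally 0).
Proof.
intros hs.
pose proof (low_user_density_proper s (admissible_lam12_pos s hs)) as FF.
set (c := sum_files s (fun f => popularity s f * q f /
            (lam12 s * Rpower (P12 s * B12 s) (2 / alpha s) + q f)) / 3.5).
set (phi := fun x => 1 - Rpower (1 + x * c) (- 3.5)).
apply (filterlim_ext_loc (fun t => phi (lamu t / lam2 t))).
- exists (mkposreal 1 Rlt_0_1); intros l1 l2 lu H1 H2 Hu Hl _.
  unfold phi, pa2.
  change (lam12 (with_densities s l1 l2 lu)) with (l1 / l2); rewrite Hl.
  simpl (lamu _); simpl (lam2 _).
  f_equal; f_equal; f_equal.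
  unfold c; change (sum_files (with_densities s l1 l2 lu)) with (sum_files s).
  change (popularity (with_densities s l1 l2 lu)) with (popularity s).
  change (P12 (with_densities s l1 l2 lu)) with (P12 s).
  change (B12 (with_densities s l1 l2 lu)) with (B12 s).
  change (alpha (with_densities s l1 l2 lu)) with (alpha s).
  field; lra.
- apply filterlim_comp with (1 := user_ratio_lim s).
  replace 0 with (phi 0) at 2.
  + apply (ex_derive_continuous (V := R_NormedModule)).
    unfold phi, Rpower; auto_derive; lra.
  + unfold phi, Rpower; rewrite Rmult_0_l, Rplus_0_r, ln_1, Rmult_0_r, exp_0.
    ring.
Qed.

(** With [lam12] fixed, the densities enter [Poff] only through [pa2]. Continuity in [pa2] at 0
    holds because the denominators there are [C1 s + q f > 0]. *)
Lemma Poff_lim_correct (s : network) (q : nat -> R) :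
  admissible s -> caching_vector s q ->
  filterlim (fun t => Poff t q) (low_user_density s) (locally (Poff_lim s q)).
Proof.
intros hs Hq.
pose proof (low_user_density_proper s (admissible_lam12_pos s hs)) as FF.
pose proof (C1_pos s hs) as HC.
set (phi := fun v => sum_files s (fun f => popularity s f * q f /
    (C1 s + C2 s * v + C3 s * v * q f + q f))).
apply (filterlim_ext_loc (fun t => phi (pa2 t q))).
- exists (mkposreal 1 Rlt_0_1); intros l1 l2 lu H1 H2 Hu Hl _.
  assert (HC1 : C1 (with_densities s l1 l2 lu) = C1 s).
  { unfold C1; change (lam12 (with_densities s l1 l2 lu)) with (l1 / l2).
    rewrite Hl; reflexivity. }
  unfold phi, Poff; rewrite HC1; reflexivity.
- apply filterlim_comp with (1 := pa2_lim s q hs).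
  apply (filterlim_sum_n_m_1 (fun v f => popularity s f * q f /
    (C1 s + C2 s * v + C3 s * v * q f + q f))).
  intros f Hf; specialize (Hq f Hf).
  replace (popularity s f * q f / (C1 s + q f)) with
    (popularity s f * q f / (C1 s + C2 s * 0 + C3 s * 0 * q f + q f))
    by (f_equal; f_equal; ring).
  apply (ex_derive_continuous (V := R_NormedModule)
    (fun v => popularity s f * q f / (C1 s + C2 s * v + C3 s * v * q f + q f))).
  auto_derive; lra.
Qed.

(** * Existence of the multiplier and optimality *)

Lemma multiplier_exists (s : network) :
  admissible s ->
  exists nu, 0 < nu /\ sum_files s (qstar s nu) = INR (Nc s).
Proof.
intros hs.
pose proof (C1_pos s hs) as HC.
destruct (admissible_files s hs) as [HN1 HN2].
set (T := fun mu => sum_files s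
  (fun f => clip01 (mu * sqrt (popularity s f) - C1 s))).
assert (Hsq : forall f, 0 < sqrt (popularity s f)).
{ intros f; apply sqrt_lt_R0, popularity_pos; lia. }
assert (HT : continuity T).
{ intros mu; apply continuity_pt_filterlim.
  apply (filterlim_sum_n_m_1
    (fun m f => clip01 (m * sqrt (popularity s f) - C1 s))).
  intros f _.
  apply (continuous_comp (fun m => m * sqrt (popularity s f) - C1 s) clip01);
    [|apply continuous_clip01].
  apply (ex_derive_continuous (V := R_NormedModule)); auto_derive; exact I. }
assert (HT0 : T 0 = 0).
{ unfold T, sum_files.
  rewrite (sum_n_m_ext_loc (G := R_AbelianMonoid) _ (fun _ => 0)).
  - apply (sum_n_m_const_zero (G := R_AbelianMonoid)).
  - intros k _; rewrite Rmult_0_l; unfold clip01.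
    rewrite Rmin_left, Rmax_right by lra; reflexivity. }
(* At [mu = B] every clip is saturated at 1, so the total is [Nf]. *)
destruct (finite_upper_bound
  (fun f => (1 + C1 s) / sqrt (popularity s f)) (Nf s)) as [B [HB0 HB]].
assert (HTB : T B = INR (Nf s)).
{ unfold T, sum_files.
  rewrite (sum_n_m_ext_loc (G := R_AbelianMonoid) _ (fun _ => 1)).
  - rewrite sum_n_m_const, Rmult_1_r; f_equal; lia.
  - intros k Hk; specialize (HB k Hk); apply Rle_div_l in HB; [|apply Hsq].
    unfold clip01; rewrite Rmin_right, Rmax_left by lra; reflexivity. }
assert (HNc : 1 <= INR (Nc s) <= INR (Nf s)).
{ split; [apply (le_INR 1)|apply le_INR]; lia. }
destruct (IVT_gen T 0 B (INR (Nc s)) HT) as [mu [Hmu Heq]].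
{ rewrite HT0, HTB, Rmin_left, Rmax_right by lra; lra. }
rewrite Rmin_left, Rmax_right in Hmu by lra.
assert (Hmu0 : 0 < mu).
{ destruct (proj1 Hmu) as [H|H]; [exact H|].
  rewrite <- H, HT0 in Heq; lra. }
(* Solves [mu = sqrt (C1 s / nu)] for [nu]; [mu] is nonzero because [T 0 = 0] while [Nc >= 1]. *)
exists (C1 s / mu ^ 2).
assert (0 < mu ^ 2) by (apply pow_lt; exact Hmu0).
split; [apply Rdiv_lt_0_compat; lra|].
unfold qstar.
replace (C1 s / (C1 s / mu ^ 2)) with (mu ^ 2) by (field; lra).
rewrite sqrt_pow2 by lra; exact Heq.
Qed.

(** Weak duality: summing the gaps bounds the gain of a feasible [q] over [qstar] by
    [nu * (sum_files s q - Nc)], which is at most 0. *)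
Lemma qstar_unique_maximizer (s : network) (nu : R) :
  admissible s -> 0 < nu -> sum_files s (qstar s nu) = INR (Nc s) ->
  unique_maximizer s (Poff_lim s) (qstar s nu).
Proof.
intros hs Hnu Hsum.
pose proof (C1_pos s hs) as HC.
destruct (admissible_files s hs) as [HN1 HN2].
set (L := fun q f => popularity s f * q f / (C1 s + q f) + - nu * q f).
assert (HL : forall q, sum_files s (L q) = Poff_lim s q - nu * sum_files s q).
{ intros q; unfold L, Poff_lim, sum_files.
  rewrite (sum_n_m_plus (G := R_AbelianMonoid)
    (fun f => popularity s f * q f / (C1 s + q f)) (fun f => - nu * q f)).
  rewrite (sum_n_m_mult_l (K := R_Ring) (- nu) q).
  assert (E : forall a b, a + - nu * b = a - nu * b) by (intros; ring).
  apply E. }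
assert (Hgap : forall q, caching_vector s q -> forall f, is_file s f ->
  L q f + nu * (qstar s nu f - q f) ^ 2 / (C1 s + q f) <= L (qstar s nu) f).
{ intros q Hq f Hf; unfold L.
  pose proof (lagrangian_gap (C1 s) nu (popularity s f) (q f) HC Hnu
    (popularity_pos s f ltac:(lia)) (Hq f Hf)) as H.
  fold (qstar s nu f) in H; simpl in H |- *; lra. }
assert (Hnonneg : forall q, caching_vector s q -> forall f, is_file s f ->
  0 <= nu * (qstar s nu f - q f) ^ 2 / (C1 s + q f)).
{ intros q Hq f Hf; specialize (Hq f Hf).
  apply Rdiv_le_0_compat; [|lra].
  apply Rmult_le_pos; [lra|apply pow2_ge_0]. }
assert (Hle : forall q, caching_vector s q -> forall f, is_file s f ->
  L q f <= L (qstar s nu) f).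
{ intros q Hq f Hf.
  pose proof (Hgap q Hq f Hf); pose proof (Hnonneg q Hq f Hf); lra. }
split; [|split].
- split; [intros f _; apply clip01_bounds|lra].
- intros q [Hq Hc].
  pose proof (sum_n_m_1_le _ _ _ (Hle q Hq)) as H.
  fold (sum_files s (L q)) (sum_files s (L (qstar s nu))) in H.
  rewrite !HL, Hsum in H; nra.
- intros q [Hq Hc] Heq f Hf.
  (* Equal objectives and [sum_files s q <= Nc] make the total Lagrangian of [q] at least that of
     [qstar], so each file attains equality and its quadratic gap must be 0. *)
  assert (HE : L q f = L (qstar s nu) f).
  { apply (sum_n_m_1_le_eq _ _ (Nf s) (Hle q Hq)); [|exact Hf].
    fold (sum_files s (L q)) (sum_files s (L (qstar s nu))).
    rewrite !HL, Hsum, Heq; nra. }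
  pose proof (Hgap q Hq f Hf) as H; rewrite HE in H.
  pose proof (Hnonneg q Hq f Hf) as H0.
  pose proof (Hq f Hf) as Hqf.
  assert (Hz : nu * (qstar s nu f - q f) ^ 2 / (C1 s + q f) = 0) by lra.
  destruct (Req_dec (q f) (qstar s nu f)) as [E|E]; [exact E|exfalso].
  assert (0 < nu * (qstar s nu f - q f) ^ 2 / (C1 s + q f)); [|lra].
  apply Rdiv_lt_0_compat; [|lra].
  apply Rmult_lt_0_compat; [exact Hnu|apply pow2_gt_0; lra].
Qed.

Theorem mainTheorem3 (s : network) (hs : admissible s) :
  (forall q : nat -> R, caching_vector s q ->
     filterlim (fun t => pa2 t q) (low_user_density s) (locally 0) /\
     filterlim (fun t => Poff t q) (low_user_density s)
       (locally (Poff_lim s q))) /\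
  (exists nu : R, 0 < nu /\ sum_files s (qstar s nu) = INR (Nc s)) /\
  (forall nu : R, 0 < nu -> sum_files s (qstar s nu) = INR (Nc s) ->
     unique_maximizer s (Poff_lim s) (qstar s nu)).
Proof.
split; [|split].
- intros q Hq; split; [apply pa2_lim, hs|apply Poff_lim_correct; assumption].
- apply multiplier_exists, hs.
- intros nu Hnu Hsum; apply qstar_unique_maximizer; assumption.
Qed.
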